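(* Let $\mathbb{X}$ be a real normed linear space and let $x\in\mathbb{X}$ satisfy the $\alpha$-left existence property. Then $x$ is $\rho$-right symmetric if and only if for every $y\in S_\mathbb{X}$ the following two conditions hold: (i) $x\in y^{\rho+}$ implies $y\in x^{\rho+}$; (ii) $x\in y^{\rho-}$ implies $y\in x^{\rho-}$.
   Context: All normed spaces are real; $S_\mathbb{X}=\{x\in\mathbb{X}:\|x\|=1\}$. Norm derivatives: $\rho'_{\pm}(x,y)=\|x\|\lim_{t\to 0^{\pm}}\frac{\|x+ty\|-\|x\|}{t}$ and $\rho'(x,y)=\frac12(\rho'_+(x,y)+\rho'_-(x,y))$. $\rho$-orthogonality: $x\perp_\rho y$ means $\rho'(x,y)=0$. An element $x\in\mathbb{X}$ is $\rho$-right symmetric if $y\perp_\rho x$ implies $x\perp_\rho y$ for all $y\in\mathbb{X}$. For $x,y\in\mathbb{X}$: $y\in x^{\rho+}$ means $\rho'(x,y)\ge 0$, and $y\in x^{\rho-}$ means $\rho'(x,y)\le 0$. An element $x\in\mathbb{X}$ satisfies the $\alpha$-left existence property if for every $y\in\mathbb{X}$ there exists $\alpha\in\mathbb{R}$ such that $\alpha x+y\perp_\rho x$. *)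

(* Defs.v *)
From HB Require Import structures.
From mathcomp Require Import all_boot all_order all_algebra.
From mathcomp Require Import all_classical all_reals all_analysis.

Set Implicit Arguments.
Unset Strict Implicit.
Unset Printing Implicit Defensive.

Import Order.TTheory GRing.Theory Num.Theory.
Import numFieldNormedType.Exports.

Local Open Scope classical_set_scope.
Local Open Scope ring_scope.

Section NormDerivatives.
Variables (R : realType) (X : normedModType R).
Implicit Types x y : X.

Definition unit_sphere : set X := [set x | `|x| = 1].

(* The one-sided limits below always exist, because t |-> `|x + t *: y| is
   convex; hence the default value of lim is never used. *)
Definition rho_plus x y : R :=
  `|x| * lim ((`|x + t *: y| - `|x|) / t @[t --> 0^'+]).

Definition rho_minus x y : R :=
  `|x| * lim ((`|x + t *: y| - `|x|) / t @[t --> 0^'-]).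

Definition rho x y : R := 2^-1 * (rho_plus x y + rho_minus x y).

Definition rho_orthogonal x y : Prop := rho x y = 0.

Definition rho_right_symmetric x : Prop :=
  forall y, rho_orthogonal y x -> rho_orthogonal x y.

Definition rho_nonneg x : set X := [set y | 0 <= rho x y].

Definition rho_nonpos x : set X := [set y | rho x y <= 0].

Definition alpha_left_existence x : Prop :=
  forall y, exists alpha : R, rho_orthogonal (alpha *: x + y) x.

End NormDerivatives.

Arguments unit_sphere {R} X.

(* Main.v *)
(* Only the forward implication needs an idea.  Suppose [0 <= rho y x] and pick
   [a] with [z := a *: x + y] rho-orthogonal to [x]; by right symmetry
   [rho x z = 0], where morally [rho x z = a * `|x| ^+ 2 + rho x y], so it
   suffices to exclude [a > 0] unless [rho x y = 0].  If [a > 0], then along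
   the convex function [t |-> `|y + t *: x|] the sum of the one-sided
   derivatives is nonnegative at [0] and zero at [a], hence zero at [0] by
   monotonicity.  So [rho y x = 0], and right symmetry gives [rho x y = 0].
   Condition (ii) is condition (i) for [- y]. *)
Require Import Defs.
From HB Require Import structures.
From mathcomp Require Import all_boot all_order all_algebra.
From mathcomp Require Import all_classical all_reals all_analysis.
From mathcomp Require Import ring lra.

Set Implicit Arguments.
Unset Strict Implicit.
Unset Printing Implicit Defensive.

Import Order.TTheory GRing.Theory Num.Theory.
Import numFieldNormedType.Exports.

Local Open Scope classical_set_scope.
Local Open Scope ring_scope.

Section NormDerivativeTheory.
Variables (R : realType) (X : normedModType R).
Implicit Types (x y : X) (a s t m : R).

Definition norm_quotient x y t : R := (`|x + t *: y| - `|x|) / t.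

(** The factor-free right derivative. The left one is [- dnorm_plus x (- y)], so a single one-sided
    limit carries the whole theory. *)
Definition dnorm_plus x y : R := lim (norm_quotient x y t @[t --> 0^'+]).

Lemma norm_quotientN x y t : norm_quotient x y (- t) = - norm_quotient x (- y) t.
Proof. by rewrite /norm_quotient scaleNr -scalerN invrN mulrN. Qed.

(** Convexity of the norm: triangle inequality on [t *: (x + s *: y) = (t - s) *: x + s *: (x + t *:
    y)]. *)
Lemma norm_quotient_nondecreasing x y s t :
  0 < s -> s <= t -> norm_quotient x y s <= norm_quotient x y t.
Proof.
move=> s0 st; have t0 : 0 < t by exact: lt_le_trans st.
rewrite /norm_quotient ler_pdivrMr// mulrAC ler_pdivlMr//.
have : `|t *: (x + s *: y)| <= `|(t - s) *: x| + `|s *: (x + t *: y)|.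
  apply: le_trans (ler_normD _ _); rewrite scalerBl !scalerDr !scalerA (mulrC t s).
  by rewrite addrA subrK.
rewrite !normrZ (gtr0_norm t0) (gtr0_norm s0) ger0_norm ?subr_ge0//.
set A := `|x + s *: y|; set B := `|x + t *: y|; set N := `|x|; nra.
Qed.

(** Triangle inequality on [(s + t) *: x = s *: (x + t *: y) + t *: (x - s *: y)]. It bounds the
    quotients below, so the right limit exists, and later compares the two one-sided derivatives. *)
Lemma norm_quotient_le_opp x y s t :
  0 < s -> 0 < t -> - norm_quotient x (- y) s <= norm_quotient x y t.
Proof.
move=> s0 t0; rewrite /norm_quotient -mulNr opprB.
rewrite ler_pdivrMr// mulrAC ler_pdivlMr//.
have : `|(s + t) *: x| <= `|s *: (x + t *: y)| + `|t *: (x + s *: - y)|.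
  apply: le_trans (ler_normD _ _); rewrite scalerDl !scalerDr !scalerN !scalerA.
  by rewrite (mulrC t s) addrACA subrr addr0.
rewrite !normrZ (gtr0_norm t0) (gtr0_norm s0) gtr0_norm ?addr_gt0//.
set A := `|x + s *: - y|; set B := `|x + t *: y|; set N := `|x|; nra.
Qed.

Lemma norm_quotient_is_cvg x y :
  cvg (norm_quotient x y t @[t --> 0^'+]).
Proof.
apply: (nondecreasing_at_right_is_cvgr (a := 0)).
  near=> b => s t; rewrite !in_itv/= => /andP[s0 _] _.
  exact: norm_quotient_nondecreasing.
near=> b; exists (- norm_quotient x (- y) 1) => _ [t /= + <-].
rewrite in_itv/= => /andP[t0 _]; exact: norm_quotient_le_opp.
Unshelve. all: by end_near. Qed.

Lemma dnorm_plus_le x y t : 0 < t -> dnorm_plus x y <= norm_quotient x y t.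
Proof.
move=> t0; apply: limr_le; first exact: norm_quotient_is_cvg.
near=> s; apply: norm_quotient_nondecreasing => //.
by near: s; exact: nbhs_right_le.
Unshelve. all: by end_near. Qed.

(** With [dnorm_plus_le], this makes [dnorm_plus x y] the infimum of the quotients over [t > 0];
    later inequalities are proved through these two bounds. *)
Lemma le_dnorm_plus x y m :
  (forall t, 0 < t -> m <= norm_quotient x y t) -> m <= dnorm_plus x y.
Proof.
move=> h; apply: limr_ge; first exact: norm_quotient_is_cvg.
by near=> s; apply: h.
Unshelve. all: by end_near. Qed.

Lemma dnorm_minusE x y :
  lim (norm_quotient x y t @[t --> 0^'-]) = - dnorm_plus x (- y).
Proof.
apply/cvg_lim => //; apply/cvg_at_leftNP; rewrite oppr0.
have -> : norm_quotient x y \o -%R = - norm_quotient x (- y).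
  by apply/funext => t; exact: norm_quotientN.
by apply: cvgN; exact: norm_quotient_is_cvg.
Qed.

Lemma rhoE x y :
  rho x y = 2^-1 * (`|x| * (dnorm_plus x y - dnorm_plus x (- y))).
Proof. by rewrite -dnorm_minusE mulrDr. Qed.

Lemma rhoNr x y : rho x (- y) = - rho x y.
Proof. by rewrite !rhoE opprK; ring. Qed.

Lemma dnorm_plusNN x y : dnorm_plus (- x) (- y) = dnorm_plus x y.
Proof.
suff qE : norm_quotient (- x) (- y) = norm_quotient x y by rewrite /dnorm_plus qE.
by apply/funext => t; rewrite /norm_quotient scalerN -opprD !normrN.
Qed.

Lemma rhoNl x y : rho (- x) y = - rho x y.
Proof.
rewrite !rhoE normrN dnorm_plusNN -[in dnorm_plus (- x) y](opprK y).
by rewrite dnorm_plusNN; ring.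
Qed.

Lemma rho0l y : rho 0 y = 0.
Proof. by rewrite rhoE normr0 mul0r mulr0. Qed.

Lemma rho0r x : rho x 0 = 0.
Proof. by rewrite rhoE oppr0 subrr !mulr0. Qed.

Lemma norm_quotientZl a x y t :
  0 < a -> norm_quotient (a *: x) y t = norm_quotient x y (t / a).
Proof.
move=> a0; rewrite /norm_quotient.
have -> : a *: x + t *: y = a *: (x + (t / a) *: y).
  by rewrite scalerDr scalerA mulrCA divff ?gt_eqF// mulr1.
by rewrite !normrZ gtr0_norm// -mulrBr invf_div; ring.
Qed.

Lemma dnorm_plusZl a x y : 0 < a -> dnorm_plus (a *: x) y = dnorm_plus x y.
Proof.
move=> a0; apply/eqP; rewrite eq_le; apply/andP; split.
  apply: le_dnorm_plus => t t0.
  rewrite -(mulfK (lt0r_neq0 a0) t) -norm_quotientZl//.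
  by apply: dnorm_plus_le; rewrite mulr_gt0.
apply: le_dnorm_plus => t t0; rewrite norm_quotientZl//.
by apply: dnorm_plus_le; rewrite divr_gt0.
Qed.

Lemma rhoZl a x y : 0 < a -> rho (a *: x) y = a * rho x y.
Proof. by move=> a0; rewrite !rhoE !dnorm_plusZl// normrZ gtr0_norm//; ring. Qed.

Lemma norm_quotientZr a x y t :
  0 < a -> norm_quotient x (a *: y) t = a * norm_quotient x y (t * a).
Proof.
move=> a0; rewrite /norm_quotient scalerA invfM mulrCA [in RHS](mulrCA a).
by rewrite divff ?gt_eqF// mulr1.
Qed.

Lemma dnorm_plusZr a x y :
  0 < a -> dnorm_plus x (a *: y) = a * dnorm_plus x y.
Proof.
have le b z : 0 < b -> b * dnorm_plus x z <= dnorm_plus x (b *: z).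
  move=> b0; apply: le_dnorm_plus => t t0.
  by rewrite norm_quotientZr// ler_pM2l// dnorm_plus_le// mulr_gt0.
move=> a0; apply/eqP; rewrite eq_le le// andbT -ler_pdivrMl//.
(* The reverse inequality is [le] for the scalar [a^-1] and the vector [a *: y]. *)
have ai0 : 0 < a^-1 by rewrite invr_gt0.
by have := le _ (a *: y) ai0; rewrite scalerA mulVf ?gt_eqF// scale1r.
Qed.

Lemma rhoZr a x y : 0 < a -> rho x (a *: y) = a * rho x y.
Proof. by move=> a0; rewrite !rhoE -scalerN !dnorm_plusZr//; ring. Qed.

(** Pulling the factor [1 + t * a] out of [x + t *: (a *: x + y)] reparametrises [t]. *)
Lemma norm_quotient_shift a x y t : 0 < t -> 0 < 1 + t * a ->
  norm_quotient x (a *: x + y) t =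
  a * `|x| + norm_quotient x y (t / (1 + t * a)).
Proof.
move=> t0 ta0; rewrite /norm_quotient.
have -> : x + t *: (a *: x + y) =
    (1 + t * a) *: (x + (t / (1 + t * a)) *: y).
  rewrite [RHS]scalerDr scalerA mulrCA divff ?gt_eqF// mulr1.
  by rewrite scalerDr scalerA scalerDl scale1r addrA.
rewrite normrZ gtr0_norm// invf_div; field; exact: lt0r_neq0.
Qed.

(** For [0 <= a] the factor [1 + t * a] is positive at every [t > 0], so the infimum bounds apply
    directly; this half of the shift identity suffices below. *)
Lemma rho_shift_ge a x y : 0 <= a ->
  a * `|x| ^+ 2 + rho x y <= rho x (a *: x + y).
Proof.
move=> a0; rewrite !rhoE.
have plus : a * `|x| + dnorm_plus x y <= dnorm_plus x (a *: x + y).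
  apply: le_dnorm_plus => t t0.
  have ta0 : 0 < 1 + t * a by rewrite ltr_pwDl// mulr_ge0// ltW.
  by rewrite norm_quotient_shift// lerD2l dnorm_plus_le// divr_gt0.
have minus : a * `|x| + dnorm_plus x (- (a *: x + y)) <= dnorm_plus x (- y).
  apply: le_dnorm_plus => t t0.
  have ta0 : 0 < 1 + t * a by rewrite ltr_pwDl// mulr_ge0// ltW.
  have -> : - y = a *: x + - (a *: x + y) by rewrite opprD addNKr.
  by rewrite norm_quotient_shift// lerD2l dnorm_plus_le// divr_gt0.
have n0 := normr_ge0 x.
move: plus minus n0.
set A := dnorm_plus x y; set B := dnorm_plus x _; set C := dnorm_plus x _.
set D := dnorm_plus x _; set N := `|x| => plus minus n0.
have : N * (2 * (a * N) + (A - D)) <= N * (B - C).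
  by apply: ler_wpM2l => //; lra.
lra.
Qed.

Lemma dnorm_minus_le_plus x y : - dnorm_plus x (- y) <= dnorm_plus x y.
Proof.
apply: le_dnorm_plus => t t0; rewrite lerNl; apply: le_dnorm_plus => s s0.
by rewrite lerNl norm_quotient_le_opp.
Qed.

(* Both sides are separated by the slope of [t |-> `|y + t *: x|] over [0, a]. *)
Lemma dnorm_plus_le_minus_shift a x y : 0 < a ->
  dnorm_plus y x <= - dnorm_plus (a *: x + y) (- x).
Proof.
move=> a0; apply: le_trans (dnorm_plus_le y x a0) _.
rewrite lerNr; apply: le_trans (dnorm_plus_le _ _ a0) _.
by rewrite /norm_quotient scalerN addrAC subrr add0r -mulNr opprB (addrC y).
Qed.

(** Writing [l] and [r] for the left and right derivatives along the line from [y] in direction [x],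
    [l(0) <= r(0) <= l(a) <= r(a)]. From [l(a) + r(a) = 0] comes [l(a) <= 0], hence
    [l(0) + r(0) <= 0]. Nonzero base points allow cancelling the norm factors. *)
Lemma rho_ge0_eq0_shift a x y : 0 < a -> y != 0 -> a *: x + y != 0 ->
  0 <= rho y x -> rho (a *: x + y) x = 0 -> rho y x = 0.
Proof.
move=> a0 y0 z0; rewrite !rhoE pmulr_rge0// pmulr_rge0 ?normr_gt0// => yx.
move=> /eqP; rewrite !mulf_eq0 invr_eq0 pnatr_eq0 normr_eq0 (negbTE z0)/=.
move=> /eqP zx.
have := dnorm_minus_le_plus y x.
have := dnorm_minus_le_plus (a *: x + y) x.
have := dnorm_plus_le_minus_shift x y a0.
move=> h1 h2 h3.
have -> : dnorm_plus y x - dnorm_plus y (- x) = 0 by lra.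
by rewrite !mulr0.
Qed.

Lemma rho_right_symmetric_ge0 x y :
  alpha_left_existence x -> rho_right_symmetric x -> y != 0 ->
  0 <= rho y x -> 0 <= rho x y.
Proof.
move=> hx sx y0 yx; have [->|x0] := eqVneq x 0; first by rewrite rho0l.
have nx0 : 0 < `|x| ^+ 2 by rewrite exprn_gt0// normr_gt0.
have [a zx] := hx y; have := sx _ zx; rewrite /rho_orthogonal => xz.
have [a0|a0] := leP a 0.
  (* Here [y] is the shift of [z = a *: x + y] by [- a], and [rho x z = 0]. *)
  have na0 : 0 <= - a by rewrite oppr_ge0.
  have := rho_shift_ge x (a *: x + y) na0.
  rewrite xz addr0 scaleNr addKr; apply: le_trans.
  by rewrite mulr_ge0// ltW.
(* If [z = 0], then [y = - (a *: x)] and [rho y x = - a * rho x x < 0], against [yx]. *)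
have [zE|z0] := eqVneq (a *: x + y) 0.
  have xx : 0 < rho x x.
    have := rho_shift_ge x 0 (@ler01 R).
    rewrite scale1r addr0 rho0r mul1r addr0; exact: lt_le_trans.
  move: yx; have -> : y = - (a *: x) by apply/eqP; rewrite -addr_eq0 addrC zE.
  by rewrite rhoNl rhoZl// oppr_ge0 leNgt mulr_gt0.
by rewrite (sx y (rho_ge0_eq0_shift a0 y0 z0 yx zx)).
Qed.

End NormDerivativeTheory.

Theorem theorem3p9 (R : realType) (X : normedModType R) (x : X)
    (hx : alpha_left_existence x) :
  rho_right_symmetric x <->
  (forall y : X, unit_sphere X y ->
     (rho_nonneg y x -> rho_nonneg x y) /\
     (rho_nonpos y x -> rho_nonpos x y)).
Proof.
split=> [sx y y1|h y yx].
  have y0 : y != 0 by rewrite -normr_eq0 y1 oner_eq0.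
  split; first exact: rho_right_symmetric_ge0.
  rewrite /rho_nonpos/= => yx; rewrite -oppr_ge0 -rhoNr.
  by apply: rho_right_symmetric_ge0; rewrite ?oppr_eq0// rhoNl oppr_ge0.
have [->|y0] := eqVneq y 0; first exact: rho0r.
have n0 : 0 < `|y| by rewrite normr_gt0.
(* The conditions concern unit vectors only; positive homogeneity of [rho] in each argument carries
   them to [y]. *)
have u1 : unit_sphere X (`|y|^-1 *: y).
  by rewrite /unit_sphere/= normrZ normfV normr_id mulVf// gt_eqF.
have ux : rho (`|y|^-1 *: y) x = 0.
  by rewrite rhoZl ?invr_gt0// yx mulr0.
have [] := h _ u1; rewrite /rho_nonneg /rho_nonpos/= ux.
move=> /(_ (lexx _)) ge0 /(_ (lexx _)) le0.
have /eqP : rho x (`|y|^-1 *: y) = 0 by apply/eqP; rewrite eq_le le0 ge0.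
by rewrite rhoZr ?invr_gt0// mulf_eq0 invr_eq0 gt_eqF//= => /eqP.
Qed.
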